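(* Let $p,q,d$ be positive integers such that $p\ge q\ge d+1$. There exists a positive integer $c=c(p,q,d)$ such that the following holds. For any set $S\subset\mathbb{R}^d$ and any finite family $\mathcal{B}$ of axis-parallel boxes in $\mathbb{R}^d$, if among every $p$ boxes in $\mathcal{B}$ there are $q$ whose intersection contains a point of $S$, then there is a set of $c$ points of $S$ such that every box in $\mathcal{B}$ contains at least one of these points.
   Context: An axis-parallel box in $\mathbb{R}^d$ is a set of the form $[a_1,b_1]\times\cdots\times[a_d,b_d]$ with $a_i\le b_i$ real numbers.
   Formalization: The formal theorem assumes in addition that every box of the family contains a point of S (without this the claim fails, e.g. S empty and a single box), and ''a set of c points'' is read as a set of at most c points, since S may have fewer than c. *)

(* Defs.v *)
From mathcomp Require Import all_boot all_order all_algebra finmap.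
From mathcomp Require Import boolp classical_sets reals.

Set Implicit Arguments.
Unset Strict Implicit.
Unset Printing Implicit Defensive.

Import Order.TTheory GRing.Theory Num.Theory.

Local Open Scope classical_set_scope.
Local Open Scope ring_scope.

Definition box (R : realType) (d : nat) (a b : 'rV[R]_d) : set 'rV[R]_d :=
  [set x | forall j : 'I_d, a 0 j <= x 0 j <= b 0 j].

Definition is_box (R : realType) (d : nat) (A : set 'rV[R]_d) : Prop :=
  exists a b : 'rV[R]_d, (forall j : 'I_d, a 0 j <= b 0 j) /\ A = box a b.

(* A finite family is indexed by a finite type, so that repetitions are allowed
   and counted with multiplicity; a family without repetitions is an injective
   [B]. *)
Definition pq_property (R : realType) (d p q : nat) (S : set 'rV[R]_d)
    (I : finType) (B : I -> set 'rV[R]_d) : Prop :=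
  forall P : {set I}, #|P| = p ->
    exists Q : {set I}, [/\ Q \subset P, #|Q| = q
      & (S `&` \bigcap_(i in [set` Q]) B i) !=set0].

(* Main.v *)
Require Import Defs.
From mathcomp Require Import all_boot all_order all_algebra finmap zify.
From mathcomp Require Import boolp classical_sets reals.

Set Implicit Arguments.
Unset Strict Implicit.
Unset Printing Implicit Defensive.

Import Order.TTheory GRing.Theory Num.Theory.

Local Open Scope classical_set_scope.
Local Open Scope ring_scope.

(* Cut each coordinate axis into O(M) cells, each of which is a point or carries
   at most 1/M of the given weight; a box that meets a product cell without
   containing it has an endpoint in one of the non-degenerate cells.
   - Take M large in terms of p, q, d and weights on the boxes.  If every point
     of S lay in boxes of total weight at most W/M, then each of the O(M^d)
     product cells would contain points of S in boxes of weight at most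
     (2d+1)W/M, so for p random boxes the probability that some q of them share
     a point of S would be O(M^d M^-q) = O(1/M), as q > d: this contradicts the
     (p, q) condition.  Hence some point of S always lies in a 1/M-fraction of
     the boxes.
   - Picking such points repeatedly, while doubling the weights of the boxes
     that are missed, yields a list of points of S such that every box contains
     more than a 1/D-fraction of the list.
   - Cutting the axes with respect to this list, one listed point per product
     cell suffices to pierce all the boxes. *)

(** * Cutting the axes into cells *)

(* The cell of [x] is read off the sum of the weights below [x], taken with and
   without [x] itself and rounded down to multiples of [W / M]: if two points
   have the same cell, the two roundings agree on it. *)
Lemma quantizer (disp : Order.disp_t) (T : orderType disp) (J : finType)
    (w : J -> nat) (v : J -> T) (M : nat) :
  exists k : T -> 'I_(2 * M).+1,
    (forall x y, (x <= y)%O -> (k x <= k y)%N) /\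
    (forall x y, x != y -> k x = k y ->
      (M * \sum_(j | k (v j) == k x) w j <= \sum_j w j)%N).
Proof.
pose W := (\sum_j w j)%N.
pose F x := (\sum_(j | (v j < x)%O) w j)%N.
pose G x := (\sum_(j | (v j <= x)%O) w j)%N.
pose f x := ((M * F x) %/ W)%N; pose g x := ((M * G x) %/ W)%N.
have sub_sum (P Q : pred J) : (forall j, P j -> Q j) ->
    (\sum_(j | P j) w j <= \sum_(j | Q j) w j)%N.
  move=> PQ; rewrite big_mkcond [leqRHS]big_mkcond leq_sum // => j _.
  by case: ifP => // /PQ->.
have divW (n : nat) : (n <= W -> (M * n) %/ W <= M)%N.
  case: (posnP W) => [->|W0 nW]; first by rewrite divn0.
  by rewrite (leq_trans (leq_div2r W (leq_mul (leqnn M) nW))) ?mulnK.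
have fM x : (f x <= M)%N by apply: divW; apply: sub_sum.
have gM x : (g x <= M)%N by apply: divW; apply: sub_sum.
have fg x : (f x <= g x)%N.
  by apply: leq_div2r; apply: leq_mul => //; apply: sub_sum => j /ltW.
have gf x y : (x < y)%O -> (g x <= f y)%N.
  move=> xy; apply: leq_div2r; apply: leq_mul => //.
  by apply: sub_sum => j /le_lt_trans; apply.
have ff x y : (x <= y)%O -> (f x <= f y)%N.
  move=> xy; apply: leq_div2r; apply: leq_mul => //.
  by apply: sub_sum => j /lt_le_trans; apply.
have gg x y : (x <= y)%O -> (g x <= g y)%N.
  move=> xy; apply: leq_div2r; apply: leq_mul => //.
  by apply: sub_sum => j /le_trans; apply.
pose k x : 'I_(2 * M).+1 := inord (f x + g x).
have kE x : k x = (f x + g x)%N :> nat.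
  by rewrite inordK // ltnS mul2n -addnn leq_add.
(* Both [f] and [g] are monotone, so their sum cannot repeat unless each of them does. *)
have kfg x y : k x = k y -> f x = f y /\ g x = g y.
  move=> /(congr1 val) /=; rewrite !kE => E.
  have [xy|/ltW xy] := leP x y.
    by have := ff _ _ xy; have := gg _ _ xy; lia.
  by have := ff _ _ xy; have := gg _ _ xy; lia.
exists k; split=> [x y xy|]; first by rewrite !kE leq_add ?ff ?gg.
suff key x y : (x < y)%O -> k x = k y ->
    (M * \sum_(j | k (v j) == k x) w j <= \sum_j w j)%N.
  move=> x y; rewrite neq_lt => /orP[] xy kxy; first exact: key kxy.
  by rewrite kxy; exact: key (esym kxy).
move=> xy kxy.
(* Two distinct points in one cell force [g x <= f y = f x], so the whole cell rounds to a single
   multiple of [W / M]; comparing the extreme values of [v] in it bounds its weight by one step. *)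
have fgx : f x = g x.
  by have [_ gxy] := kfg _ _ kxy; have [fxy _] := kfg _ _ kxy;
    apply/eqP; rewrite eqn_leq fg /= fxy gf.
have [j0 j0x|noj] := pickP (fun j => k (v j) == k x); last first.
  by rewrite big_pred0 ?muln0.
case: (@arg_minP _ _ _ j0 (fun j => k (v j) == k x) v j0x) => j1 /eqP j1x j1min.
case: (@arg_maxP _ _ _ j0 (fun j => k (v j) == k x) v j0x) => j2 /eqP j2x j2max.
have cellFG : (\sum_(j | k (v j) == k x) w j + F (v j1) <= G (v j2))%N.
  rewrite /F /G big_mkcond [X in (_ + X)%N]big_mkcond [leqRHS]big_mkcond.
  rewrite -big_split leq_sum //= => j _.
  case: ifPn => [kj|_].
    by rewrite ltNge j1min //= [X in if X then _ else _]j2max // addn0.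
  case: ifPn => // jj1; rewrite add0n ifT //.
  by apply: le_trans (ltW jj1) (j2max _ _); rewrite j1x.
case: (posnP W) => [W0|W0].
  have := sub_sum (fun j => k (v j) == k x) xpredT (fun=> fun=> isT).
  by rewrite -/W W0 leqn0 => /eqP->; rewrite muln0.
have [fj1 _] := kfg _ _ j1x; have [_ gj2] := kfg _ _ j2x.
have h1 := leq_trunc_div (M * F (v j1)) W.
have h2 := ltn_ceil (M * G (v j2)) W0.
rewrite -/(f _) fj1 in h1; rewrite -/(g _) gj2 -fgx mulSn in h2.
have := leq_mul (leqnn M) cellFG; rewrite mulnDr -/W; lia.
Qed.

(** In a coordinate where [y] leaves the box, an endpoint lies between the coordinates of [x] and
    [y], and monotonicity puts it in their common cell. *)
Lemma box_crossing (R : realType) (d N : nat) (k : 'I_d -> R -> 'I_N)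
    (a b x y : 'rV[R]_d) :
  (forall j r s, r <= s -> (k j r <= k j s)%N) ->
  box a b x -> ~ box a b y -> (forall j, k j (x 0 j) = k j (y 0 j)) ->
  exists j, x 0 j != y 0 j /\
    (k j (a 0 j) == k j (x 0 j)) || (k j (b 0 j) == k j (x 0 j)).
Proof.
move=> kh bx /existsNP[j] /negP; rewrite negb_and -!ltNge => yj kxy.
have /andP[ax xb] := bx j.
exists j; split.
  apply/eqP => xyj; move: yj; rewrite -xyj; apply/negP.
  by rewrite negb_or -!leNgt ax.
case/orP: yj => /ltW yj; apply/orP; [left|right]; rewrite -val_eqE eqn_leq.
  by rewrite /= kh //= kxy kh.
by rewrite /= andbC kh //= kxy kh.
Qed.

(** * Averaging over tuples and reweighting *)

(** Union bound over [c] and at most [2 ^ p] sets [K]: the tuples sent into [E c] on [K] weigh the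
    [m]-th power of the weight of [E c], times [W ^ (p - m)]. *)
Lemma tuple_weight (I D : finType) (w : I -> nat) (E : D -> {set I})
    (p m M A : nat) :
  (M * \sum_c (\sum_(i in E c) w i) ^ m <= A * (\sum_i w i) ^ m)%N ->
  (M * \sum_(f : {ffun 'I_p -> I} |
      [exists c, exists K : {set 'I_p},
         (#|K| == m) && [forall k in K, f k \in E c]])
    \prod_k w (f k) <= 2 ^ p * A * (\sum_i w i) ^ p)%N.
Proof.
move=> hE; set W := (\sum_i w i)%N in hE *.
have prodE c (K : {set 'I_p}) : #|K| = m ->
    (\sum_(f : {ffun 'I_p -> I} | [forall k in K, f k \in E c])
      \prod_k w (f k) = (\sum_(i in E c) w i) ^ m * W ^ (p - m))%N.
  move=> Km.
  have -> : ((\sum_(i in E c) w i) ^ m * W ^ (p - m) =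
      \prod_(k < p) \sum_(i | (k \in K) ==> (i \in E c)) w i)%N.
    rewrite (bigID (mem K)) /= -Km; congr (_ * _)%N.
      rewrite -prod_nat_const; apply: eq_bigr => k kK.
      by apply: eq_bigl => i; rewrite kK.
    have -> : (p - #|K| = #|~: K|)%N.
      by rewrite [RHS]cardsCs finset.setCK card_ord.
    rewrite -prod_nat_const; apply: eq_big => k; first by rewrite inE.
    by rewrite inE => /negbTE kK; apply: eq_bigl => i; rewrite kK.
  rewrite (bigA_distr_big_dep (fun k i => (k \in K) ==> (i \in E c))).
  apply: eq_bigl => f; apply/forallP/familyP => h k; exact: h.
apply: (@leq_trans (M * \sum_c \sum_(K : {set 'I_p} | #|K| == m)
    \sum_(f : {ffun 'I_p -> I} | [forall k in K, f k \in E c])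
      \prod_k w (f k))).
  rewrite leq_mul2l; apply/orP; right.
  rewrite big_mkcond /=.
  under [leqRHS]eq_bigr do under eq_bigr do rewrite big_mkcond /=.
  under [leqRHS]eq_bigr do rewrite exchange_big /=.
  rewrite exchange_big /= leq_sum // => f _.
  case: ifP => // /existsP[c /existsP[K /andP[Km Kf]]].
  by rewrite (bigD1 c) //= (bigD1 K) //= Kf -addnA leq_addr.
under eq_bigr => c _ do under eq_bigr => K Km do rewrite prodE ?(eqP Km) //.
under eq_bigr => c _ do rewrite sum_nat_const.
have [mp|pm] := leqP m p; last first.
  rewrite big1 ?muln0 // => c _; rewrite (_ : #|_| = 0%N) ?mul0n //.
  apply: eq_card0 => K; rewrite unfold_in; apply/negbTE; rewrite neq_ltn.
  by rewrite (leq_ltn_trans (max_card _)) ?card_ord.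
rewrite -big_distrr /= -big_distrl /=.
set s := (\sum_c _)%N in hE *.
have cardK : (#|[pred K : {set 'I_p} | #|K| == m]| <= 2 ^ p)%N.
  rewrite (leq_trans (max_card _)) // -[X in (_ <= X)%N]/(2 ^ p)%N.
  by rewrite -cardsT -powersetT card_powerset cardsT card_ord.
have -> : (W ^ p = W ^ m * W ^ (p - m))%N by rewrite -expnD subnKC.
have := leq_mul cardK (leq_mul hE (leqnn (W ^ (p - m)))).
congr (_ <= _)%N; last by rewrite !mulnA.
by rewrite [RHS]mulnCA !mulnA.
Qed.

(* After [n] rounds box [i] has weight [2 ^ (n - number of hits of i)], while
   the total weight has grown by at most [2 - 1/M] per round. *)
Lemma multiplicative_weights (I : finType) (X : Type) (S : X -> Prop)
    (h : X -> I -> bool) (M : nat) :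
  (0 < M)%N ->
  (forall w : I -> nat, (forall i, 0 < w i)%N ->
    exists2 x, S x & (\sum_i w i <= M * \sum_(i | h x i) w i)%N) ->
  exists s : seq X, (forall k : 'I_(size s), S (tnth (in_tuple s) k)) /\
    forall i, (size s < 3 * (2 * M).-1 * count (h^~ i) s)%N.
Proof.
move=> M0 heavy; pose a := (2 * M).-1; pose D := (3 * a)%N.
have aM : (a.+1 = 2 * M)%N by rewrite /a prednK // muln_gt0.
have a0 : (0 < a)%N by rewrite /a; lia.
have mw n : exists s : seq X, [/\ size s = n,
    forall k : 'I_(size s), S (tnth (in_tuple s) k)
    & (M ^ n * \sum_i 2 ^ (n - count (h^~ i) s) <= a ^ n * #|I|)%N].
  elim: n => [|n [s [sn Ss ws]]].
    exists [::]; split=> //; first by case.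
    by rewrite !mul1n sum1_card.
  pose w i := (2 ^ (n - count (h^~ i) s))%N.
  have [|x Sx hx] := heavy w; first by move=> i; rewrite expn_gt0.
  exists (x :: s); split; first by rewrite /= sn.
    move=> k; rewrite (tnth_nth x) /=.
    case: k => -[|k] kn //=; have kn' : (k < size s)%N by [].
    by have := Ss (Ordinal kn'); rewrite (tnth_nth x).
  have wE i : (2 ^ (n.+1 - count (h^~ i) (x :: s)) + (if h x i then w i else 0)
      = 2 * w i)%N.
    rewrite /w /=; case: (h x i); rewrite ?add1n ?subSS ?add0n ?addn0.
      by lia.
    by rewrite subSn ?expnS // -sn count_size.
  have sumE : (\sum_i 2 ^ (n.+1 - count (h^~ i) (x :: s)) + \sum_(i | h x i) w i
      = 2 * \sum_i w i)%N.
    by rewrite [X in (_ + X)%N]big_mkcond -big_split big_distrr; apply: eq_bigr.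
  have := leq_mul (leqnn a) ws.
  rewrite !expnS -[X in (X <= _ -> _)%N]/(a * (M ^ n * \sum_i w i))%N.
  set U := (\sum_i 2 ^ _)%N in sumE *; set V := (\sum_i w i)%N in hx sumE *.
  have MU : (M * U <= a * V)%N.
    have : (M * (2 * V) = a * V + V)%N.
      by rewrite mulnA [(M * 2)%N]mulnC -aM mulSn addnC.
    by rewrite -sumE mulnDr; lia.
  have := leq_mul (leqnn (M ^ n)) MU; lia.
(* The factor 3 in [D] is chosen for this: by Bernoulli, [(1 + 1 / a) ^ (3 * a) >= 1 + 3]. *)
have bern : (4 * a ^ D <= (2 * M) ^ D)%N.
  have bernoulli n : (a ^ n * (a + n) <= a.+1 ^ n * a)%N.
    elim: n => [|n IH]; first by rewrite addn0.
    have := leq_mul (leqnn a.+1) IH; rewrite !expnS.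
    by have : (0 <= n * a ^ n)%N by []; nia.
  have := bernoulli D; rewrite -aM /D.
  have -> : (a + 3 * a = 4 * a)%N by lia.
  by rewrite mulnA leq_pmul2r // [(_ * 4)%N]mulnC.
have [s [sn Ss ws]] := mw (D * #|I|)%N.
exists s; split=> // i; rewrite -/D sn ltn_mul2l; apply/andP; split.
  by rewrite /D; lia.
(* With [n = #|I|], at most [n] hits in [D * n] rounds would give
   [(2 * M / a) ^ (D * n) <= 2 ^ n * n]; the left side is at least [4 ^ n] by [bern], against
   [n < 2 ^ n]. *)
rewrite ltnNge; apply/negP => ci.
set n := #|I| in sn ws ci.
have wi : (M ^ (D * n) * 2 ^ (D * n - n) <= a ^ (D * n) * n)%N.
  apply: leq_trans ws; rewrite leq_mul2l (bigD1 i) //=; apply/orP; right.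
  by apply: leq_trans (leq_addr _ _); rewrite leq_exp2l // leq_sub2l.
have nD : (n <= D * n)%N by rewrite leq_pmull // /D; lia.
have e1 : (2 ^ n * (4 * a ^ D) ^ n <= 2 ^ n * (2 * M) ^ (D * n))%N.
  rewrite leq_mul2l expnM; apply/orP; right.
  by case: (posnP n) => [->//|n0]; rewrite leq_exp2r.
have e2 : ((2 * M) ^ (D * n) = 2 ^ n * (M ^ (D * n) * 2 ^ (D * n - n)))%N.
  by rewrite expnMn -{1}(subnKC nD) expnD; lia.
have e3 : ((4 * a ^ D) ^ n = 2 ^ n * 2 ^ n * a ^ (D * n))%N.
  by rewrite expnMn -expnM -expnMn.
have e4 : (0 < 2 ^ n)%N by rewrite expn_gt0.
have e5 : (0 < a ^ (D * n))%N by rewrite expn_gt0 a0.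
have e6 := ltn_expl n (isT : 1 < 2)%N.
have : (2 ^ n * a ^ (D * n) <= a ^ (D * n) * n)%N.
  apply: leq_trans wi; rewrite -(leq_pmul2l e4) -e2.
  by rewrite -(leq_pmul2l e4) (leq_trans _ e1) // e3; lia.
by rewrite mulnC leq_pmul2l // leqNgt e6.
Qed.

(** * Boxes against product cells *)

(** [K] takes one index per product cell. If no listed point in the box had its representative there
    too, each would share a light axis cell with one of the [2 * d] endpoints, which accounts for at
    most [2 * d * n / M < n / D] points. *)
Lemma box_net (R : realType) (d D n : nat) (X : 'I_n -> 'rV[R]_d) :
  exists2 K : {set 'I_n}, (#|K| <= (4 * d.+1 * D).+1 ^ d)%N &
    forall a b, (n < D * #|[set t | `[< box a b (X t) >]]%SET|)%N ->
      exists2 t, t \in K & box a b (X t).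
Proof.
pose M := (2 * d.+1 * D)%N.
have /choice[k kP] (j : 'I_d) := quantizer (fun=> 1%N) (fun t => X t 0 j) M.
have kh j := (kP j).1.
case: n X k kP kh => [|n] X k kP kh.
  exists finset.set0 => [|a b]; first by rewrite cards0.
  by rewrite (_ : #|_| = 0%N) ?muln0 //; apply: eq_card0 => -[].
pose cell t := [ffun j => k j (X t 0 j)].
have cellE t j : cell t j = k j (X t 0 j) by rewrite ffunE.
(* For an empty cell the default [ord0] is a harmless extra index. *)
pose rep c := odflt ord0 [pick t | cell t == c].
have cell_rep t : cell (rep (cell t)) = cell t.
  by rewrite /rep; case: pickP => [t' /eqP|/(_ t)] //=; rewrite eqxx.
exists [set rep c | c in finset.setT]%SET.
  rewrite (leq_trans (leq_imset_card _ _)) // cardsT card_ffun !card_ord.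
  by rewrite (_ : 2 * M = 4 * d.+1 * D)%N // /M; lia.
move=> a b; set G := [set t | _]%SET => big.
have [t [tG rt]] : exists t, t \in G /\ box a b (X (rep (cell t))).
  apply: contrapT => none.
  (* [L'] discards the heavy, hence one-point, cells. *)
  pose L j r := (\sum_(t | k j (X t 0%R j) == k j r) 1)%N.
  pose L' j r := (if M * L j r <= n.+1 then L j r else 0)%N.
  have L'M j r : (M * L' j r <= n.+1)%N.
    by rewrite /L'; case: ifP; rewrite ?muln0.
  have GL : (#|G| <= \sum_(j < d) (L' j (a 0 j)%R + L' j (b 0 j)%R))%N.
    have L'E j r : L' j r = (\sum_(t < n.+1)
        ((M * L j r <= n.+1) && (k j (X t 0%R j) == k j r)))%N.
      rewrite /L' /L; case: ifP => _; last by rewrite big1.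
      by rewrite big_mkcond.
    under eq_bigr do rewrite !L'E -big_split /=.
    rewrite exchange_big /= -sum1_card big_mkcond leq_sum //= => t _.
    case: ifPn => // tG.
    have [|||j [ne kab]] :=
      @box_crossing R d _ k a b (X t) (X (rep (cell t))) kh.
    - by move: tG; rewrite inE => /asboolP.
    - by move=> rt; apply: none; exists t.
    - by move=> j; have /ffunP/(_ j) := cell_rep t; rewrite !cellE.
    have kt : k j (X t 0 j) = k j (X (rep (cell t)) 0 j).
      by have /ffunP/(_ j) := cell_rep t; rewrite !cellE.
    have := (kP j).2 _ _ ne kt.
    rewrite /= -/(L j _) sum1_card card_ord => light.
    have Leq r : k j r = k j (X t 0 j) -> L j r = L j (X t 0 j).
      by rewrite /L => ->.
    rewrite (bigD1 j) //= -addnA.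
    case/orP: kab => /eqP kr; rewrite (Leq _ kr) light kr eqxx /=; lia.
  have : (M * #|G| <= d * (2 * n.+1))%N.
    apply: leq_trans (leq_mul (leqnn M) GL) _.
    rewrite big_distrr /= -[X in (_ <= X * _)%N](card_ord d) -sum_nat_const.
    by apply: leq_sum => j _; rewrite mulnDr mul2n -addnn leq_add.
  by rewrite /M; move: big; set g := #|G|; nia.
by exists (rep (cell t)) => //; apply: imset_f.
Qed.

(** In the bound on [M], [2 ^ p] counts the index sets of a tuple, [3 ^ d * (2 * d).+1 ^ q] pays for
    [q] boxes meeting [S] in a common cell, and the added 1 pays for repeated boxes; some tuple then
    avoids both. *)
Lemma heavy_point (R : realType) (p q d M : nat) (S : set 'rV[R]_d)
    (I : finType) (B : I -> set 'rV[R]_d) (w : I -> nat) :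
  (d < q)%N -> (2 ^ p * (3 ^ d * (2 * d).+1 ^ q).+1 < M)%N ->
  (forall i, is_box (B i)) -> (forall i, (S `&` B i) !=set0) ->
  pq_property p q S B -> (0 < \sum_i w i)%N ->
  exists2 x, S x & (\sum_i w i <= M * \sum_(i | `[< B i x >]) w i)%N.
Proof.
move=> dq Mbig Bbox SB pq W0; apply: contrapT => noheavy.
have light x : S x -> (M * \sum_(i | `[< B i x >]) w i <= \sum_i w i)%N.
  move=> Sx; rewrite leqNgt; apply/negP => /ltnW hx.
  by apply: noheavy; exists x.
have /choice[ab abP] i : exists u : 'rV[R]_d * 'rV[R]_d, B i = box u.1 u.2.
  by have [a [b [_ ->]]] := Bbox i; exists (a, b).
pose endpt j (u : I * bool) := if u.2 then (ab u.1).1 0 j else (ab u.1).2 0 j.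
have /choice[k kP] (j : 'I_d) :=
  quantizer (fun u : I * bool => w u.1) (endpt j) M.
have endptW : (\sum_(u : I * bool) w u.1 = 2 * \sum_i w i)%N.
  rewrite -(pair_bigA _ (fun i (s : bool) => w i)) big_distrr.
  by apply: eq_bigr => i _; rewrite big_bool /= addnn mul2n.
set W := (\sum_i w i)%N in W0 light endptW.
pose cell (x : 'rV[R]_d) := [ffun j => k j (x 0 j)].
have cellE x j : cell x j = k j (x 0 j) by rewrite ffunE.
pose E c := [set i | `[< exists x, [/\ S x, B i x & cell x = c] >]]%SET.
(* Fix one point [y] of [S] in the cell. Boxes of [E c] containing [y] weigh at most [W / M]; the
   others have an endpoint in a light axis cell, at most [2 * W / M] per axis since all endpoints
   together weigh [2 * W]. *)
have wE c : (M * \sum_(i in E c) w i <= (2 * d).+1 * W)%N.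
  have [[y [Sy yc]]|noy] := pselect (exists y, S y /\ cell y = c); last first.
    rewrite big1 ?muln0 // => i; rewrite inE => /asboolP[x [Sx _ xc]].
    by case: noy; exists x.
  pose L j := (\sum_(u : I * bool | k j (endpt j u) == k j (y 0%R j)) w u.1)%N.
  pose L' j := (if M * L j <= 2 * W then L j else 0)%N.
  have EL : (\sum_(i in E c) w i <=
      \sum_(i | `[< B i y >]) w i + \sum_(j < d) L' j)%N.
    have L'E j : L' j = (\sum_i \sum_(s : bool)
        if (M * L j <= 2 * W)%N && (k j (endpt j (i, s)) == k j (y 0%R j))
        then w i else 0)%N.
      rewrite /L'; case: ifP => _; last by rewrite big1 // => i _; rewrite big1.
      by rewrite pair_bigA /L big_mkcond; apply: eq_bigr => -[].
    under [X in (_ <= _ + X)%N]eq_bigr do rewrite L'E.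
    rewrite exchange_big /= big_mkcond [X in (_ <= X + _)%N]big_mkcond.
    rewrite -big_split leq_sum //= => i _.
    case: ifPn => // iE; case: ifPn => [_|/asboolPn iy]; first exact: leq_addr.
    move: iE; rewrite inE => /asboolP[x [Sx ix xc]].
    have xy j : k j (x 0 j) = k j (y 0 j) by rewrite -!cellE xc yc.
    rewrite abP in ix iy.
    have [j [ne kab]] := box_crossing (fun j => (kP j).1) ix iy xy.
    have := (kP j).2 _ _ ne (xy j); rewrite endptW xy -/(L j) => Lj.
    rewrite (bigD1 j) //= big_bool Lj /endpt /= -!xy.
    by case/orP: kab => /eqP->; rewrite eqxx; lia.
  apply: leq_trans (leq_mul (leqnn M) EL) _.
  rewrite mulnDr mulSn leq_add ?light //.
  apply: (@leq_trans (\sum_(j < d) 2 * W)); last first.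
    by rewrite sum_nat_const card_ord mulnA [(d * 2)%N]mulnC.
  rewrite big_distrr leq_sum //= => j _.
  by rewrite /L'; case: ifP; rewrite ?muln0.
have M0 : (0 < M)%N by exact: leq_ltn_trans Mbig.
(* At most [(3 * M) ^ d] cells contribute at most [((2 * d).+1 * W / M) ^ q] each; as [q > d], a
   factor [1 / M] is left. *)
have cells : (M * \sum_c (\sum_(i in E c) w i) ^ q <=
    3 ^ d * (2 * d).+1 ^ q * W ^ q)%N.
  have Mq : (0 < M ^ q.-1)%N by rewrite expn_gt0 M0.
  rewrite -(leq_pmul2l Mq) mulnA -expnSr prednK ?(leq_ltn_trans _ dq) //.
  rewrite big_distrr /=.
  apply: (@leq_trans (\sum_(c : {ffun 'I_d -> 'I_(2 * M).+1})
    ((2 * d).+1 * W) ^ q)).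
    by apply: leq_sum => c _; rewrite -expnMn leq_exp2r ?(leq_ltn_trans _ dq).
  rewrite sum_nat_const card_ffun !card_ord expnMn !mulnA leq_mul //.
  rewrite leq_mul //.
  apply: (@leq_trans ((3 * M) ^ d)).
    by case: (posnP d) => [->//|d0]; rewrite leq_exp2r //; lia.
  by rewrite expnMn mulnC leq_mul // leq_exp2l //; lia.
(* The singletons as sets [E] make the random tuple injective. *)
have repeats : (M * \sum_i (\sum_(i' in [set i]%SET) w i') ^ 2 <= 1 * W ^ 2)%N.
  rewrite mul1n -mulnn {1}/W big_distrl big_distrr leq_sum //= => i _.
  rewrite big_set1 -mulnn mulnCA leq_mul //.
  (* Each box holds a point of [S], so its own weight is at most [W / M]. *)
  have [x [Sx ix]] := SB i; apply: leq_trans (light _ Sx).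
  by rewrite leq_mul // (bigD1 i) ?leq_addr //; apply/asboolP.
pose P1 (f : {ffun 'I_p -> I}) := [exists c, exists K : {set 'I_p},
  (#|K| == q) && [forall k in K, f k \in E c]].
pose P2 (f : {ffun 'I_p -> I}) := [exists i, exists K : {set 'I_p},
  (#|K| == 2) && [forall k in K, f k \in [set i]%SET]].
have bad1 : (M * \sum_(f | P1 f) \prod_j w (f j) <=
    2 ^ p * (3 ^ d * (2 * d).+1 ^ q) * W ^ p)%N := tuple_weight p cells.
have bad2 : (M * \sum_(f | P2 f) \prod_j w (f j) <= 2 ^ p * 1 * W ^ p)%N :=
  tuple_weight p repeats.
have total : (\sum_(f : {ffun 'I_p -> I}) \prod_j w (f j) = W ^ p)%N.
  by rewrite -(bigA_distr_bigA (fun=> w)) prod_nat_const card_ord.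
have [f /norP[f1 f2]] : exists f, ~~ (P1 f || P2 f).
  apply: contrapT => allbad.
  have : (M * W ^ p <= 2 ^ p * (3 ^ d * (2 * d).+1 ^ q).+1 * W ^ p)%N.
    rewrite -[(3 ^ d * _).+1]addn1 mulnDr mulnDl.
    apply: leq_trans (leq_add bad1 bad2).
    rewrite -total -mulnDr leq_mul // [X in (_ <= X + _)%N]big_mkcond
      [X in (_ <= _ + X)%N]big_mkcond.
    rewrite -big_split leq_sum //= => f _.
    have : P1 f || P2 f by apply: contrapT => /negP nf; apply: allbad; exists f.
    by case: (P1 f) (P2 f) => -[] //= _; rewrite ?leq_addr ?leq_addl.
  by rewrite leq_pmul2r ?expn_gt0 ?W0 // leqNgt Mbig.
have finj : injective f.
  move=> u v fuv; apply/eqP/negP => /negP uv; move/negP: f2; apply.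
  apply/existsP; exists (f u); apply/existsP; exists [set u; v]%SET.
  rewrite cards2 uv /=; apply/forall_inP => l.
  by rewrite !inE => /orP[] /eqP->; rewrite ?fuv.
have [|Q [Qf Qq [x [Sx Bx]]]] := pq (f @: finset.setT)%SET.
  by rewrite card_imset // cardsT card_ord.
(* Boxes sharing the point [x] of [S] all lie in [E (cell x)], and injectivity of [f] turns them
   into exactly [q] indices. *)
move/negP: f1; apply; apply/existsP; exists (cell x); apply/existsP.
exists (f @^-1: Q)%SET; apply/andP; split.
  rewrite -(card_imset _ finj) -Qq; apply/eqP; congr #|pred_of_set _|.
  apply/setP => i; apply/imsetP/idP => [[l]|iQ]; first by rewrite inE => lQ ->.
  have /imsetP[l _ il] := fintype.subsetP Qf _ iQ.
  by exists l; rewrite // inE -il.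
apply/forall_inP => l; rewrite !inE => lQ.
by exists x; split=> //; apply: Bx.
Qed.

(* Every box is required to contain a point of [S]: a box missing [S] can never
   be pierced by [S], although the (p, q) condition tolerates such boxes when
   q < p or when the family has fewer than p members.  As S may have fewer than
   c points, "c points" means at most c points. *)
Theorem theorem1p4 (R : realType) (p q d : nat)
    (p_gt0 : (0 < p)%N) (q_gt0 : (0 < q)%N) (d_gt0 : (0 < d)%N)
    (q_le_p : (q <= p)%N) (d_lt_q : (d + 1 <= q)%N) :
  exists2 c : nat, (0 < c)%N &
    forall (S : set 'rV[R]_d) (I : finType) (B : I -> set 'rV[R]_d),
      (forall i : I, is_box (B i)) ->
      (forall i : I, (S `&` B i) !=set0) ->
      pq_property p q S B ->
      exists T : {fset 'rV[R]_d},
        [/\ (#|` T| <= c)%N, [set` T] `<=` S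
          & forall i : I, exists2 x : 'rV[R]_d, x \in T & B i x].
Proof.
(* [M] is the least value that [heavy_point] allows, and [D] is the constant that
   [multiplicative_weights] then yields. *)
pose M := (2 ^ p * (3 ^ d * (2 * d).+1 ^ q).+1).+1.
pose D := (3 * (2 * M).-1)%N.
exists ((4 * d.+1 * D).+1 ^ d)%N; first by rewrite expn_gt0.
move=> S I B Bbox SB pq.
have [i0 _|noI] := pickP (@predT I); last first.
  by exists fset0; split=> [|x|i]; rewrite ?cardfs0 ?inE //; have := noI i.
have [||s [Ss sB]] := @multiplicative_weights I _ S (fun x i => `[< B i x >]) M.
- by [].
- move=> w w0; apply: (heavy_point (p := p) (q := q)) => //.
    by rewrite -addn1.
  by rewrite (bigD1 i0) //= ltn_addr.
pose X := tnth (in_tuple s).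
have [K cK netK] := box_net D X.
exists [fset X t | t in K]%fset; split.
- by rewrite (leq_trans (leq_imfset_card _ _ _)) // -cardE.
- by move=> x /= /imfsetP[t /= _ ->]; exact: Ss.
- move=> i; have [a [b [_ Bi]]] := Bbox i.
  have [|t tK Xt] := netK a b.
    rewrite -Bi cardsE -sum1_card /X.
    have := sB i; rewrite -sum1_count big_tnth.
    by congr (_ < _ * _)%N; apply: eq_bigl => t; rewrite unfold_in.
  by exists (X t); [apply/imfsetP; exists t | rewrite Bi].
Qed.
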